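(* Let $\Bbbk$ be a field and let $\mathcal{C}$ be a pseudo-diagrammatic $\Bbbk$-linear rigid monoidal category. Then $\mathcal{U}(\mathcal{C})=\mathcal{U}^{\mathrm{ex}}(\mathcal{C})$; that is, every non-zero morphism $u\colon U\to\mathbf{1}$ in $\mathcal{C}$ is a coequalizer of the two morphisms $u\otimes U,\ U\otimes u\colon U\otimes U\to U$.
   Context: Rigid means that every object has a left and a right dual. $\mathbf 1$ denotes the tensor unit, and an object $U$ also denotes its identity morphism in expressions such as $u\otimes U$; the canonical identifications $\mathbf 1\otimes U\cong U\cong U\otimes\mathbf 1$ are suppressed. $\mathcal{C}(U,V)$ denotes the hom-space. A pseudo-diagrammatic category is a $\Bbbk$-linear monoidal category $\mathcal{C}$ for which there are bases $B_{U,V}$ of the hom-spaces $\mathcal{C}(U,V)$, for all $U,V\in\mathcal{C}$, such that (a) the tensor product in $\mathcal{C}$ restricts to an injective map $B_{U,V}\times B_{U',V'}\hookrightarrow B_{U\otimes U',V\otimes V'}$ for all $U,U',V,V'\in\mathcal{C}$, and (b) whenever $b\otimes b'$ factors through $\mathbf 1$ for basis elements $b,b'$, then both $b$ and $b'$ factor through $\mathbf 1$. $\mathcal{U}(\mathcal{C})$ is the collection of all non-zero morphisms $u\in\mathcal{C}(U,\mathbf 1)$, for objects $U\in\mathcal{C}$, and $\mathcal{U}^{\mathrm{ex}}(\mathcal{C})$ is the subcollection of those $u\colon U\to\mathbf{1}$ which are a coequalizer of $u\otimes U$ and $U\otimes u$, i.e. a cokernel of $u\otimes U-U\otimes u$.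 The equality $\mathcal{U}(\mathcal{C})=\mathcal{U}^{\mathrm{ex}}(\mathcal{C})$ is the ''necessary exactness condition'' for the existence of an abelian envelope. *)

(* Defs.v *)
From HB Require Import structures.
From mathcomp Require Import all_boot all_order all_algebra.

Set Implicit Arguments.
Unset Strict Implicit.
Unset Printing Implicit Defensive.

Import GRing.Theory.
Local Open Scope ring_scope.

Section Basis.
Variables (k : fieldType) (V : lmodType k).
Implicit Type B : V -> Prop.

(* Possibly infinite bases: the combinations are finite, the set [B] need not be. *)
Definition lin_independent B : Prop :=
  forall (s : seq V) (c : V -> k), uniq s -> (forall v, v \in s -> B v) ->
    \sum_(v <- s) c v *: v = 0 -> forall v, v \in s -> c v = 0.

Definition spanning B : Prop :=
  forall w : V, exists (s : seq V) (c : V -> k),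
    (forall v, v \in s -> B v) /\ w = \sum_(v <- s) c v *: v.

Definition is_basis B : Prop := lin_independent B /\ spanning B.
End Basis.

Record linCat (k : fieldType) : Type := LinCat {
  obj :> Type;
  mor : obj -> obj -> lmodType k;
  idm : forall U, mor U U;
  mcomp : forall U V W, mor V W -> mor U V -> mor U W;
  comp_idl : forall U V (f : mor U V), mcomp (idm V) f = f;
  comp_idr : forall U V (f : mor U V), mcomp f (idm U) = f;
  comp_assoc : forall U V W X (h : mor W X) (g : mor V W) (f : mor U V),
    mcomp h (mcomp g f) = mcomp (mcomp h g) f;
  comp_linear_l : forall U V W (f : mor U V),
    linear (fun g : mor V W => mcomp g f);
  comp_linear_r : forall U V W (g : mor V W),
    linear (fun f : mor U V => mcomp g f)
}.

Arguments mor {k} _ _ _.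
Arguments idm {k _} U.
Arguments mcomp {k _ U V W} g f.

Notation "g \oc f" := (mcomp g f) (at level 40, left associativity).

Section CategoryNotions.
Variables (k : fieldType) (C : linCat k).

Definition mutually_inverse (U V : C) (f : mor C U V) (g : mor C V U) : Prop :=
  g \oc f = idm U /\ f \oc g = idm V.

Definition is_coequalizer (A D Q : C) (f g : mor C A D) (q : mor C D Q) : Prop :=
  q \oc f = q \oc g /\
  forall (X : C) (h : mor C D X), h \oc f = h \oc g ->
    exists! w : mor C Q X, w \oc q = h.

Definition factors_through (W U V : C) (f : mor C U V) : Prop :=
  exists (p : mor C U W) (q : mor C W V), f = q \oc p.
End CategoryNotions.

Record monData (k : fieldType) : Type := MonData {
  lin_cat :> linCat k;
  munit : lin_cat;
  tens : lin_cat -> lin_cat -> lin_cat;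
  tensm : forall U V U' V', mor lin_cat U V -> mor lin_cat U' V' ->
    mor lin_cat (tens U U') (tens V V');
  assoc : forall U V W, mor lin_cat (tens (tens U V) W) (tens U (tens V W));
  associ : forall U V W, mor lin_cat (tens U (tens V W)) (tens (tens U V) W);
  lunit : forall U, mor lin_cat (tens munit U) U;
  luniti : forall U, mor lin_cat U (tens munit U);
  runit : forall U, mor lin_cat (tens U munit) U;
  runiti : forall U, mor lin_cat U (tens U munit)
}.

Arguments munit {k _}.
Arguments tens {k _} U V.
Arguments tensm {k _ U V U' V'} f g.
Arguments assoc {k _} U V W.
Arguments associ {k _} U V W.
Arguments lunit {k _} U.
Arguments luniti {k _} U.
Arguments runit {k _} U.
Arguments runiti {k _} U.

Notation "U \ot V" := (tens U V) (at level 35, right associativity).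
Notation "f \otm g" := (tensm f g) (at level 35, right associativity).

Record monLaws (k : fieldType) (C : monData k) : Prop := MonLaws {
  tensm_id : forall U V : C, idm U \otm idm V = idm (U \ot V);
  tensm_comp : forall (U V W U' V' W' : C)
    (g : mor C V W) (f : mor C U V) (g' : mor C V' W') (f' : mor C U' V'),
    (g \oc f) \otm (g' \oc f') = (g \otm g') \oc (f \otm f');
  tensm_linear_l : forall (U V U' V' : C) (f' : mor C U' V'),
    linear (fun f : mor C U V => f \otm f');
  tensm_linear_r : forall (U V U' V' : C) (f : mor C U V),
    linear (fun f' : mor C U' V' => f \otm f');
  assoc_iso : forall U V W : C, mutually_inverse (assoc U V W) (associ U V W);
  lunit_iso : forall U : C, mutually_inverse (lunit U) (luniti U);
  runit_iso : forall U : C, mutually_inverse (runit U) (runiti U);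
  assoc_nat : forall (U V W U' V' W' : C)
    (f : mor C U U') (g : mor C V V') (h : mor C W W'),
    assoc U' V' W' \oc ((f \otm g) \otm h)
      = (f \otm (g \otm h)) \oc assoc U V W;
  lunit_nat : forall (U V : C) (f : mor C U V),
    lunit V \oc (idm munit \otm f) = f \oc lunit U;
  runit_nat : forall (U V : C) (f : mor C U V),
    runit V \oc (f \otm idm munit) = f \oc runit U;
  pentagon : forall U V W X : C,
    assoc U V (W \ot X) \oc assoc (U \ot V) W X
      = (idm U \otm assoc V W X) \oc assoc U (V \ot W) X
          \oc (assoc U V W \otm idm X);
  triangle : forall U V : C,
    (idm U \otm lunit V) \oc assoc U munit V = runit U \otm idm V
}.

Record linMonCat (k : fieldType) : Type := LinMonCat {
  mon_data :> monData k;
  mon_laws : monLaws mon_data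
}.

Section MonoidalNotions.
Variables (k : fieldType) (C : linMonCat k).

(* [V] is a left dual of [U]; equivalently, [U] is a right dual of [V]. *)
Definition is_left_dual (U V : C) : Prop :=
  exists (ev : mor C (V \ot U) munit) (coev : mor C munit (U \ot V)),
    runit U \oc (idm U \otm ev) \oc assoc U V U
      \oc (coev \otm idm U) \oc luniti U = idm U /\
    lunit V \oc (ev \otm idm V) \oc associ V U V
      \oc (idm V \otm coev) \oc runiti V = idm V.

Definition rigid : Prop :=
  forall U : C,
    (exists V : C, is_left_dual U V) /\ (exists V : C, is_left_dual V U).

(* The tensor product is not assumed strict, so the convention that the
   identifications 1 (x) U = U = U (x) 1 are suppressed has to be spelled out
   for a family of bases: the bases of hom-spaces that are identified along
   unitors coincide.  If the unitors are identities this holds trivially. *)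
Definition unit_compatible (B : forall U V : C, mor C U V -> Prop) : Prop :=
  forall (U V : C) (b : mor C U V),
    [/\ B U V b <-> B (munit \ot U) V (b \oc lunit U),
        B U V b <-> B (U \ot munit) V (b \oc runit U),
        B U V b <-> B U (munit \ot V) (luniti V \oc b)
      & B U V b <-> B U (V \ot munit) (runiti V \oc b)].

Definition tens_restricts_injectively
    (B : forall U V : C, mor C U V -> Prop) : Prop :=
  forall U V U' V' : C,
    (forall (b : mor C U V) (b' : mor C U' V'), B U V b -> B U' V' b' ->
       B (U \ot U') (V \ot V') (b \otm b')) /\
    (forall (b1 b2 : mor C U V) (b1' b2' : mor C U' V'),
       B U V b1 -> B U V b2 -> B U' V' b1' -> B U' V' b2' ->
       b1 \otm b1' = b2 \otm b2' -> b1 = b2 /\ b1' = b2').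

Definition unit_factors_split (B : forall U V : C, mor C U V -> Prop) : Prop :=
  forall (U V U' V' : C) (b : mor C U V) (b' : mor C U' V'),
    B U V b -> B U' V' b' ->
    factors_through munit (b \otm b') ->
    factors_through munit b /\ factors_through munit b'.

Definition pseudo_diagrammatic : Prop :=
  exists B : forall U V : C, mor C U V -> Prop,
    [/\ forall U V : C, is_basis (B U V),
        unit_compatible B,
        tens_restricts_injectively B
      & unit_factors_split B].

Definition in_U (U : C) (u : mor C U munit) : Prop := u <> 0.

Definition in_Uex (U : C) (u : mor C U munit) : Prop :=
  in_U u /\
  is_coequalizer (lunit U \oc (u \otm idm U)) (runit U \oc (idm U \otm u)) u.
End MonoidalNotions.

Arguments rigid {k} C.
Arguments pseudo_diagrammatic {k} C.

(* Main.v *)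
Require Import Defs.
From HB Require Import structures.
From mathcomp Require Import all_boot all_order all_algebra.
From Stdlib Require Import ClassicalEpsilon.

(** Suppress unitors, let [u : U -> 1] be non-zero and let [f : U -> V] satisfy
    [u (x) f = f (x) u].  Bending the first tensor factor [U] to the left with a
    dual [X] of [U] turns this into [u^* (x) f = f^# o u], where
    [u^* : 1 -> X] is non-zero and [f^# : 1 -> X (x) V].  The right-hand side is
    a combination of basis elements that factor through [1], so by (a) and (b)
    every basis element occurring in [f] factors through [1], i.e.
    [f = \sum_j p_j o q_j] with [q_j : U -> 1].  Now
    [f (x) u = u (x) f = \sum_j (p_j o u) (x) q_j], and since tensor products of
    basis elements are independent, comparing coefficients at a basis element
    occurring in [u], on the second tensor factor, shows that [f] is of the form
    [w o u].  Independence also gives the uniqueness of [w]. *)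

Set Implicit Arguments.
Unset Strict Implicit.
Unset Printing Implicit Defensive.

Import GRing.Theory.
Local Open Scope ring_scope.

(** * Linearity of bare functions *)

Section LinearMaps.
Variables (k : fieldType) (V W : lmodType k) (f : V -> W).
Hypothesis linf : linear f.

Lemma linear_map0 : f 0 = 0.
Proof. by have := linf (-1) 0 0; rewrite scaler0 addr0 scaleN1r addNr. Qed.

Lemma linear_mapZ a x : f (a *: x) = a *: f x.
Proof. by have := linf a x 0; rewrite linear_map0 !addr0. Qed.

Lemma linear_mapB x y : f (x - y) = f x - f y.
Proof. by rewrite -[x - y]addrC -!scaleN1r linf addrC. Qed.

End LinearMaps.

(** * Coordinates with respect to a possibly infinite basis *)

Section Coordinates.
Variables (k : fieldType) (V : lmodType k) (B : V -> Prop).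
Hypothesis basisB : is_basis B.

(** Requiring [c] to vanish off the list makes it unique as a function on all of [V], whichever list
    witnesses it. *)
Definition coord_spec (w : V) (c : V -> k) : Prop :=
  exists s : seq V, [/\ uniq s, forall v, v \in s -> B v,
    forall v, v \notin s -> c v = 0 & w = \sum_(v <- s) c v *: v].

Lemma coord_spec_widen (s s' : seq V) (c : V -> k) :
  uniq s -> uniq s' -> {subset s <= s'} -> (forall v, v \notin s -> c v = 0) ->
  \sum_(v <- s) c v *: v = \sum_(v <- s') c v *: v.
Proof.
move=> us us' ss' c0; rewrite [RHS](bigID (mem s)) /= [X in _ + X]big1 ?addr0.
  rewrite -[RHS]big_filter; apply: perm_big; apply: uniq_perm => //.
    exact: filter_uniq.
  by move=> v; rewrite mem_filter andb_idr //; apply: ss'.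
by move=> v /c0 ->; rewrite scale0r.
Qed.

Lemma coord_spec_linear a w w' c c' : coord_spec w c -> coord_spec w' c' ->
  coord_spec (a *: w + w') (fun v => a * c v + c' v).
Proof.
move=> [s [us sB c0 ->]] [s' [us' sB' c0' ->]].
exists (undup (s ++ s')); split; first exact: undup_uniq.
- by move=> v; rewrite mem_undup mem_cat => /orP[/sB|/sB'].
- move=> v; rewrite mem_undup mem_cat negb_or => /andP[/c0 -> /c0' ->].
  by rewrite mulr0 addr0.
rewrite (@coord_spec_widen s (undup (s ++ s'))) ?undup_uniq //; last first.
  by move=> v vs; rewrite mem_undup mem_cat vs.
rewrite (@coord_spec_widen s' (undup (s ++ s'))) ?undup_uniq //; last first.
  by move=> v vs; rewrite mem_undup mem_cat vs orbT.
rewrite scaler_sumr -big_split /=; apply: eq_bigr => v _.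
by rewrite scalerDl scalerA.
Qed.

Lemma coord_spec_basis b : B b -> coord_spec b (fun v => (b == v)%:R).
Proof.
move=> Bb; exists [:: b]; split=> //.
- by move=> v; rewrite inE => /eqP ->.
- by move=> v; rewrite inE eq_sym => /negbTE ->.
by rewrite big_seq1 eqxx scale1r.
Qed.

Lemma coord_spec0 : coord_spec 0 (fun _ => 0).
Proof. by exists [::]; split=> //; rewrite big_nil. Qed.

Lemma coord_spec_inj w c c' : coord_spec w c -> coord_spec w c' -> c =1 c'.
Proof.
move=> wc wc' v; have := coord_spec_linear (-1) wc wc'.
rewrite scaleN1r addNr => -[s [us sB d0 /esym/(proj1 basisB _ _ us sB) d1]].
have : -1 * c v + c' v = 0 by case: (boolP (v \in s)) => [/d1|/d0].
by rewrite mulN1r addrC => /subr0_eq.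
Qed.

Lemma basis_ind (P : V -> Prop) :
  P 0 -> (forall a x y, P x -> P y -> P (a *: x + y)) ->
  (forall b, B b -> P b) -> forall w, P w.
Proof.
move=> P0 PD PB w; have [s [c [sB ->]]] := proj2 basisB w.
elim: s sB => [|v s IHs] sB; first by rewrite big_nil.
rewrite big_cons; apply: PD; first by apply/PB/sB/mem_head.
by apply: IHs => x xs; apply: sB; rewrite inE xs orbT.
Qed.

Lemma coord_spec_exists w : exists c, coord_spec w c.
Proof.
elim/basis_ind: w => [|a x y [c xc] [d yd]|b Bb].
- by eexists; apply: coord_spec0.
- by eexists; apply: coord_spec_linear xc yd.
- by eexists; apply: coord_spec_basis.
Qed.

(** By [coord_spec_inj] the choice made here does not affect the values. *)
Definition bcoord (w : V) : V -> k :=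
  proj1_sig (constructive_indefinite_description _ (coord_spec_exists w)).

Lemma bcoordP w : coord_spec w (bcoord w).
Proof. exact: proj2_sig (constructive_indefinite_description _ _). Qed.

Lemma bcoord_linear a x y b :
  bcoord (a *: x + y) b = a * bcoord x b + bcoord y b.
Proof.
exact: (coord_spec_inj (bcoordP _)
  (coord_spec_linear a (bcoordP x) (bcoordP y)) b).
Qed.

Lemma bcoord0 b : bcoord 0 b = 0.
Proof. exact: coord_spec_inj (bcoordP _) coord_spec0 b. Qed.

Lemma bcoordZ a x b : bcoord (a *: x) b = a * bcoord x b.
Proof. by rewrite -[a *: x]addr0 bcoord_linear bcoord0 addr0. Qed.

Lemma bcoord_basis b b' : B b -> bcoord b b' = (b == b')%:R.
Proof. by move=> /coord_spec_basis bc; apply: coord_spec_inj (bcoordP _) bc b'. Qed.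

Lemma bcoord_sum w : exists2 s : seq V, (forall v, v \in s -> B v) &
  w = \sum_(v <- s) bcoord w v *: v.
Proof. by have [s [_ sB _ ws]] := bcoordP w; exists s. Qed.

Lemma bcoord_eq0 w : (forall b, B b -> bcoord w b = 0) -> w = 0.
Proof.
move=> w0; have [s sB ->] := bcoord_sum w.
by rewrite big_seq big1 // => v /sB/w0 ->; rewrite scale0r.
Qed.

Lemma bcoord_inj x y : (forall b, B b -> bcoord x b = bcoord y b) -> x = y.
Proof.
move=> xy; apply: subr0_eq; apply: bcoord_eq0 => b Bb.
by rewrite addrC -scaleN1r bcoord_linear xy // mulN1r addNr.
Qed.

Lemma bcoord_neq0 w : w <> 0 -> exists2 b, B b & bcoord w b != 0.
Proof.
have [s sB ws] := bcoord_sum w => w0.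
have [/hasP[b /sB Bb wb]|/hasPn s0] := boolP (has (fun b => bcoord w b != 0) s).
  by exists b.
case: w0; rewrite ws big_seq big1 // => v /s0.
by rewrite negbK => /eqP ->; rewrite scale0r.
Qed.

End Coordinates.

(** Bilinearity reduces to basis elements [x] and [y]; there both sides are Kronecker deltas, which
    agree because [t] is injective on pairs of basis elements. *)
Lemma bcoord_bilinear (k : fieldType) (X Y Z : lmodType k)
    (BX : X -> Prop) (BY : Y -> Prop) (BZ : Z -> Prop)
    (hX : is_basis BX) (hY : is_basis BY) (hZ : is_basis BZ) (t : X -> Y -> Z)
    (tl : forall y, linear (t ^~ y)) (tr : forall x, linear (t x))
    (tB : forall b b', BX b -> BY b' -> BZ (t b b'))
    (tinj : forall b c b' c', BX b -> BX c -> BY b' -> BY c' ->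
       t b b' = t c c' -> b = c /\ b' = c') x y b b' :
  BX b -> BY b' ->
  bcoord hZ (t x y) (t b b') = bcoord hX x b * bcoord hY y b'.
Proof.
move=> Bb Bb'; elim/(basis_ind hX): x => [|a x1 x2 IH1 IH2|c Bc].
- by rewrite (linear_map0 (tl y)) !bcoord0 mul0r.
- by rewrite tl !bcoord_linear IH1 IH2 mulrDl mulrA.
elim/(basis_ind hY): y => [|a y1 y2 IH1 IH2|c' Bc'].
- by rewrite (linear_map0 (tr c)) !bcoord0 mulr0.
- by rewrite tr !bcoord_linear IH1 IH2 mulrDr mulrCA.
rewrite !bcoord_basis //; last exact: tB.
rewrite -natrM mulnb; congr (_ %:R); congr nat_of_bool.
apply/eqP/andP => [/tinj[]// -> ->|[/eqP -> /eqP ->]] //.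
Qed.

(** * Unitor coherence and transposition along duals *)

Section Monoidal.
Variables (k : fieldType) (C : linMonCat k).

Let law := mon_laws C.

Lemma tensm_split_l (U V U' V' : C) (f : mor C U V) (g : mor C U' V') :
  f \otm g = (f \otm idm V') \oc (idm U \otm g).
Proof. by rewrite -(tensm_comp law) comp_idl comp_idr. Qed.

Lemma tensm_split_r (U V U' V' : C) (f : mor C U V) (g : mor C U' V') :
  f \otm g = (idm V \otm g) \oc (f \otm idm U').
Proof. by rewrite -(tensm_comp law) comp_idl comp_idr. Qed.

Lemma luK (U : C) : lunit U \oc luniti U = idm U.
Proof. by case: (lunit_iso law U). Qed.
Lemma luiK (U : C) : luniti U \oc lunit U = idm (munit \ot U).
Proof. by case: (lunit_iso law U). Qed.
Lemma ruK (U : C) : runit U \oc runiti U = idm U.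
Proof. by case: (runit_iso law U). Qed.
Lemma ruiK (U : C) : runiti U \oc runit U = idm (U \ot munit).
Proof. by case: (runit_iso law U). Qed.
Lemma asK (U V W : C) : assoc U V W \oc associ U V W = idm _.
Proof. by case: (assoc_iso law U V W). Qed.
Lemma asiK (U V W : C) : associ U V W \oc assoc U V W = idm _.
Proof. by case: (assoc_iso law U V W). Qed.

Lemma tens1_faithful (U V : C) (f g : mor C U V) :
  idm munit \otm f = idm munit \otm g -> f = g.
Proof.
move=> /(congr1 (fun h => lunit V \oc h)); rewrite !(lunit_nat law).
by move=> /(congr1 (fun h => h \oc luniti U)); rewrite -!comp_assoc !luK !comp_idr.
Qed.

(** After tensoring with [munit] and precomposing with invertible associators, this follows from
    pentagon, triangle and naturality. *)
Lemma lunit_tens (U V : C) :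
  lunit (U \ot V) \oc assoc munit U V = lunit U \otm idm V.
Proof.
apply: tens1_faithful.
suff: (idm munit \otm (lunit (U \ot V) \oc assoc munit U V))
        \oc (assoc munit (munit \ot U) V \oc (assoc munit munit U \otm idm V))
    = (idm munit \otm (lunit U \otm idm V))
        \oc (assoc munit (munit \ot U) V \oc (assoc munit munit U \otm idm V)).
  move=> /(congr1 (fun h => h \oc ((associ munit munit U \otm idm V)
                               \oc associ munit (munit \ot U) V))).
  suff E : assoc munit (munit \ot U) V \oc (assoc munit munit U \otm idm V)
      \oc ((associ munit munit U \otm idm V) \oc associ munit (munit \ot U) V)
      = idm _ by rewrite -!comp_assoc in E *; rewrite !E !comp_idr.
  rewrite comp_assoc -[X in X \oc _ = _]comp_assoc -(tensm_comp law) asK comp_idl.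
  by rewrite (tensm_id law) comp_idr asK.
rewrite -{1}[idm munit](comp_idl (idm munit)) (tensm_comp law) -!comp_assoc.
rewrite [X in _ \oc X = _]comp_assoc -(pentagon law) comp_assoc (triangle law).
rewrite [RHS]comp_assoc -(assoc_nat law) -comp_assoc -(tensm_comp law) comp_idl.
by rewrite (triangle law) (assoc_nat law) (tensm_id law).
Qed.

(** Naturality of [lunit] at [lunit munit] identifies [lunit (munit \ot munit)] with
    [idm munit \otm lunit munit]; the triangle then makes both unitors agree after tensoring with
    [munit] on the right. *)
Lemma lunit_munit : lunit munit = runit munit :> mor C _ _.
Proof.
have E : lunit (munit \ot munit) = idm munit \otm lunit munit :> mor C _ _.
  have := lunit_nat law (lunit (munit : C)).
  move=> /(congr1 (fun h => luniti munit \oc h)).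
  by rewrite !comp_assoc luiK !comp_idl.
have := lunit_tens munit munit; rewrite E (triangle law).
move=> /(congr1 (fun h => runit munit \oc h)); rewrite !(runit_nat law).
move=> /(congr1 (fun h => h \oc runiti _)).
by rewrite -!comp_assoc ruK !comp_idr.
Qed.

(** Composites through [munit] are thus tensor products up to unitors, so that statements about
    bases of tensor products apply to them. *)
Lemma tensm_through_munit (U V : C) (p : mor C munit V) (q : mor C U munit) :
  p \otm q = runiti V \oc (p \oc q \oc lunit U).
Proof.
rewrite -comp_assoc -(lunit_nat law) lunit_munit [p \oc _]comp_assoc.
by rewrite -(runit_nat law) !comp_assoc ruiK comp_idl -tensm_split_l.
Qed.

(* [u^* (x) f = f^# o u], for the transposes [u^*] and [f^#] along [coev]. *)
Lemma tensm_transpose_factors (U V X : C) (coev : mor C munit (X \ot U))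
    (u : mor C U munit) (f : mor C U V) :
  lunit V \oc (u \otm f) = runit V \oc (f \otm u) ->
  factors_through munit
    ((runit X \oc (idm X \otm u) \oc coev) \otm f).
Proof.
move=> uf.
(* Up to unitors, the two witnesses are [u] and the transpose [(idm X \otm f) \oc coev] of [f]. *)
exists (runit munit \oc (idm munit \otm u)).
exists ((idm X \otm runit V) \oc assoc X V munit
          \oc (((idm X \otm f) \oc coev) \otm idm munit) \oc runiti munit).
rewrite comp_assoc -[_ \oc runiti munit \oc runit munit]comp_assoc ruiK comp_idr.
rewrite -[RHS]comp_assoc -tensm_split_l.
rewrite -{2}[u]comp_idr (tensm_comp law) [RHS]comp_assoc.
rewrite -[_ \oc assoc X V munit \oc _]comp_assoc (assoc_nat law).
(* Here [uf] moves [u] to the left of [f], where associativity and the triangle attach it to [X]. *)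
rewrite [_ \oc (_ \oc assoc X U U)]comp_assoc -(tensm_comp law) -uf.
rewrite (tensm_comp law) -[_ \oc assoc X U U]comp_assoc -(assoc_nat law).
rewrite [X in X \oc (coev \otm _)]comp_assoc (triangle law) -!(tensm_comp law).
by rewrite !comp_idl comp_idr.
Qed.

(** The snake identity recovers [u] from its transpose, so a zero transpose would force [u = 0]. *)
Lemma transpose_neq0 (U X : C) (ev : mor C (U \ot X) munit)
    (coev : mor C munit (X \ot U)) (u : mor C U munit) :
  lunit U \oc (ev \otm idm U) \oc associ U X U
      \oc (idm U \otm coev) \oc runiti U = idm U ->
  u <> 0 -> runit X \oc (idm X \otm u) \oc coev <> 0.
Proof.
move=> snake u0 us0; apply: u0.
have {us0} us0 : (idm X \otm u) \oc coev = 0.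
  rewrite -[LHS]comp_idl -ruiK -comp_assoc [runit X \oc _]comp_assoc us0.
  exact: linear_map0 (comp_linear_r _).
have anat : ((idm (U \ot X)) \otm u) \oc associ U X U
    = associ U X munit \oc (idm U \otm (idm X \otm u)).
  rewrite -[LHS]comp_idl -asiK -comp_assoc; congr (_ \oc _).
  rewrite comp_assoc -(tensm_id law) (assoc_nat law) -comp_assoc asK.
  exact: comp_idr.
have ev0 : (ev \otm u) \oc associ U X U \oc (idm U \otm coev) = 0.
  rewrite tensm_split_l -[X in X \oc (idm U \otm coev)]comp_assoc anat.
  rewrite -!comp_assoc -(tensm_comp law) us0 (linear_map0 (tensm_linear_r law _)).
  by rewrite !(linear_map0 (comp_linear_r _)).
rewrite -[u]comp_idr -snake !comp_assoc -(lunit_nat law).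
rewrite -[lunit munit \oc _ \oc _]comp_assoc -tensm_split_r.
rewrite -[lunit munit \oc _ \oc _]comp_assoc -[lunit munit \oc _ \oc _]comp_assoc.
by rewrite ev0 (linear_map0 (comp_linear_r _)) (linear_map0 (comp_linear_l _)).
Qed.

(** * Coefficients in bases compatible with the tensor product *)

Section PseudoDiagrammatic.
Variable B : forall U V : C, mor C U V -> Prop.
Hypotheses (basisB : forall U V : C, is_basis (B (U:=U) (V:=V)))
  (unitB : unit_compatible B) (tensB : tens_restricts_injectively B)
  (splitB : unit_factors_split B).

Lemma bcoord_tensm (U V U' V' : C) (f : mor C U V) (f' : mor C U' V') b b' :
  B b -> B b' -> bcoord (basisB _ _) (f \otm f') (b \otm b')
    = bcoord (basisB _ _) f b * bcoord (basisB _ _) f' b'.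
Proof.
apply: bcoord_bilinear.
- by move=> ?; apply: (tensm_linear_l law).
- by move=> ?; apply: (tensm_linear_r law).
- by move=> *; apply: (proj1 (tensB _ _ _ _)).
by move=> ? ? ? ? ? ? ? ?; apply: (proj2 (tensB _ _ _ _)).
Qed.

Lemma basis_comp_munit (U V : C) (p : mor C munit V) (q : mor C U munit) :
  B p -> B q -> B (p \oc q).
Proof.
move=> Bp Bq; have [_ _ _ Br] := unitB (p \oc q \oc lunit U).
have [Bl _ _ _] := unitB (p \oc q).
by apply/Bl/Br; rewrite -tensm_through_munit; apply: (proj1 (tensB _ _ _ _)).
Qed.

(** Expanding both factors of [f] in bases writes [f] as a combination of composites through [munit]
    that are themselves basis elements; [b] must be one of them. *)
Lemma basis_factors_munit (U V : C) (f b : mor C U V) :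
  factors_through munit f -> B b -> bcoord (basisB _ _) f b != 0 ->
  factors_through munit b.
Proof.
move=> [p [q ->]] Bb.
elim/(basis_ind (basisB munit V)): q => [|a x y IHx IHy|q Bq].
- by rewrite (linear_map0 (comp_linear_l _)) bcoord0 eqxx.
- rewrite comp_linear_l bcoord_linear.
  have [->|/IHx//] := eqVneq (bcoord (basisB U V) (x \oc p) b) 0.
  by rewrite mulr0 add0r.
elim/(basis_ind (basisB U munit)): p => [|a x y IHx IHy|p Bp].
- by rewrite (linear_map0 (comp_linear_r _)) bcoord0 eqxx.
- rewrite comp_linear_r bcoord_linear.
  have [->|/IHx//] := eqVneq (bcoord (basisB U V) (q \oc x) b) 0.
  by rewrite mulr0 add0r.
rewrite bcoord_basis; last exact: basis_comp_munit.
by have [<- _|_ /eqP//] := eqVneq (q \oc p) b; exists p, q.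
Qed.

(** Up to unitors [w \oc u] is [w \otm u], whose coefficients are products of those of [w] and
    [u]. *)
Lemma comp_munit_eq0 (U V : C) (u : mor C U munit) (w : mor C munit V) :
  u <> 0 -> w \oc u = 0 -> w = 0.
Proof.
move=> /(bcoord_neq0 (basisB _ _)) [q Bq uq] wu0.
apply: (bcoord_eq0 (basisB := basisB munit V)) => p Bp.
have := bcoord_tensm w u Bp Bq.
rewrite tensm_through_munit wu0 (linear_map0 (comp_linear_l _)).
rewrite (linear_map0 (comp_linear_r _)) bcoord0 => /esym/eqP.
by rewrite mulf_eq0 (negbTE uq) orbF => /eqP.
Qed.

Lemma basis_of_commuting_factors (U V : C) (u : mor C U munit) (f b : mor C U V) :
  rigid C -> u <> 0 -> lunit V \oc (u \otm f) = runit V \oc (f \otm u) ->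
  B b -> bcoord (basisB _ _) f b != 0 -> factors_through munit b.
Proof.
move=> hrigid u0 uf Bb fb.
(* [X] is a right dual of [U], and [snake] is the duality identity on [U]. *)
have [_ [X [ev [coev [_ snake]]]]] := hrigid U.
have [d Bd ud] := bcoord_neq0 (basisB _ _) (transpose_neq0 snake u0).
(* The coefficient of transpose [\otm f] at [d \otm b] is a product of non-zero scalars, so
   [d \otm b] factors through [munit]. *)
apply: (proj2 (splitB Bd Bb _)).
apply: basis_factors_munit (tensm_transpose_factors coev uf) _ _.
  exact: (proj1 (tensB _ _ _ _)).
by rewrite bcoord_tensm // mulf_neq0.
Qed.

(** Both sides are [p] after [u \otm q], since the two unitors of [munit] agree. *)
Lemma tensm_swap_munit (U V : C) (u q : mor C U munit) (p : mor C munit V) :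
  lunit V \oc (u \otm (p \oc q)) = runit V \oc ((p \oc u) \otm q).
Proof.
rewrite -{1}[u]comp_idl (tensm_comp law) comp_assoc (lunit_nat law).
rewrite lunit_munit -(runit_nat law) -comp_assoc -(tensm_comp law).
by rewrite comp_idl.
Qed.

Lemma commuting_factors (U V : C) (u : mor C U munit) (f : mor C U V) :
  rigid C -> u <> 0 -> lunit V \oc (u \otm f) = runit V \oc (f \otm u) ->
  exists w : mor C munit V, w \oc u = f.
Proof.
move=> hrigid u0 uf; have [q Bq uq] := bcoord_neq0 (basisB _ _) u0.
(* Taking the coefficient at [q] on the second factor of [u \otm g] yields [w \oc u]; the unitors
   give this morphism the target [V \ot munit] of [b \otm q]. *)
pose contracts (g : mor C U V) := exists w : mor C munit V, forall b, B b ->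
  bcoord (basisB _ _) (runiti V \oc (lunit V \oc (u \otm g))) (b \otm q)
    = bcoord (basisB _ _) (w \oc u) b.
have contracts_linear a g h : contracts g -> contracts h ->
    contracts (a *: g + h).
  move=> [v vE] [w wE]; exists (a *: v + w) => b Bb.
  rewrite (tensm_linear_r law) 2!comp_linear_r comp_linear_l.
  by rewrite !bcoord_linear vE ?wE.
have contracts0 : contracts 0.
  exists 0 => b _; rewrite (linear_map0 (tensm_linear_r law _)).
  rewrite !(linear_map0 (comp_linear_r _)) (linear_map0 (comp_linear_l _)).
  by rewrite !bcoord0.
have contracts_munit g : factors_through munit g -> contracts g.
  (* For [g = p \oc q'], [u \otm g] becomes [(p \oc u) \otm q'], whose contraction at [q] is
     [p \oc u] scaled by the coefficient of [q'] at [q]. *)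
  move=> [q' [p ->]]; exists (bcoord (basisB _ _) q' q *: p) => b Bb.
  rewrite tensm_swap_munit comp_assoc ruiK comp_idl bcoord_tensm //.
  by rewrite (linear_mapZ (comp_linear_l _)) bcoordZ mulrC.
have [w wE] : contracts f.
  have [s sB fE] := bcoord_sum (basisB _ _) f; rewrite fE big_seq.
  elim/big_rec: _ => // b g /sB Bb cg.
  have [->|fb] := eqVneq (bcoord (basisB U V) f b) 0.
    by rewrite scale0r add0r.
  apply: contracts_linear cg; apply: contracts_munit.
  exact: basis_of_commuting_factors hrigid u0 uf Bb fb.
(* By [uf] the same contraction, computed on [f \otm u], is [f] scaled by the coefficient of [u] at
   [q]. *)
exists ((bcoord (basisB _ _) u q)^-1 *: w).
rewrite (linear_mapZ (comp_linear_l _)).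
apply: (bcoord_inj (basisB := basisB U V)) => b Bb; rewrite bcoordZ -wE //.
by rewrite uf comp_assoc ruiK comp_idl bcoord_tensm // mulrC mulfK.
Qed.

End PseudoDiagrammatic.

End Monoidal.

(** * The coequalizer property *)

Theorem theorem1 (k : fieldType) (C : linMonCat k)
    (hrigid : rigid C) (hpd : pseudo_diagrammatic C) :
  forall (U : C) (u : mor C U munit), in_U u <-> in_Uex u.
Proof.
move=> U u; split=> [u0|[]//]; split=> //.
have law := mon_laws C; have [B [basisB unitB tensB splitB]] := hpd.
split=> [|V f fu].
  (* Both composites with [u] are [u \otm u] followed by the unitor of [munit]. *)
  rewrite !comp_assoc -(lunit_nat law) -(runit_nat law) lunit_munit.
  by rewrite -!comp_assoc -tensm_split_l -tensm_split_r.
have [|w wu] := commuting_factors basisB unitB tensB splitB hrigid u0 (f := f).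
  move: fu; rewrite !comp_assoc -(lunit_nat law) -(runit_nat law) -!comp_assoc.
  by rewrite -tensm_split_l -tensm_split_r.
(* For uniqueness, the difference of two solutions composes with [u] to zero. *)
exists w; split=> // w' w'u; apply: subr0_eq.
apply: (comp_munit_eq0 basisB tensB u0).
by rewrite (linear_mapB (comp_linear_l _)) wu w'u subrr.
Qed.
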